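(* Let $T=\{3,6\}/\Gamma$ be a polyhedral equivelar triangulation of the torus with $n$ vertices, with lattice $M$, sublattice $M''\subset M$, cone $\sigma^\vee\subset M_{\mathbb R}$, its support polytope $\tilde\Delta$, and cells $o_1,\dots,o_r$ of the set of vectors $A_{p,\tau_k(p)}$, where $r=\frac{n}{|\tau_1|}+\frac{n}{|\tau_2|}+\frac{n}{|\tau_3|}$ (see context). Let $\beta_1,\dots,\beta_r$ be the standard basis of $\mathbb Z^r$. Then there is an exact sequence $$0\to M''\to M\to\mathbb Z^r\to 0$$ in which the last map sends $A_{p,\tau_k(p)}\mapsto\beta_i$ if $A_{p,\tau_k(p)}\in o_i$. This projection maps $\tilde\Delta$ surjectively onto the convex hull of $\{\beta_1,\dots,\beta_r\}$, and therefore determines a Cayley structure of length $r$ on $\sigma^\vee$ (i.e. $\sigma^\vee$ is the Cayley cone associated to $r$ lattice polytopes).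
   Context: Let $\mathbb T\subset\mathbb R^2$ be the lattice generated by $\tau_1=(1,0)$, $\tau_2=\frac12(-1,\sqrt3)$, $\tau_3=\frac12(-1,-\sqrt3)$ (so $\tau_1+\tau_2+\tau_3=0$ and any two generate $\mathbb T$). $\{3,6\}$ is the tessellation of $\mathbb R^2$ by equilateral triangles with vertex set $\mathbb T$ and edges $\{p,p+\tau_k\}$. Let $\Gamma\subseteq\mathbb T$ be a sublattice of index $n$, $T=\{3,6\}/\Gamma$, $G=\mathbb T/\Gamma$. $T$ is assumed polyhedral: the intersection of two triangles is a common face (empty, a vertex or an edge). $G$ acts simply transitively on $\mathrm{vert}\,T$ by translations; $\pm\tau_k(p)$ means $p\pm\tau_k$; $|\tau_k|$ is the order of $\tau_k$ in $G$. $T$ has $3n$ edges $\{p,\tau_k(p)\}$, $p\in\mathrm{vert}\,T$, $k=1,2,3$. Convention: $\{i,j,k\}=\{1,2,3\}$. Let $\epsilon_1,\epsilon_2,\epsilon_3$ and $e_p$ ($p\in\mathrm{vert}\,T$) be the standard basis of $\mathbb Z^3\oplus\mathbb Z^n$, and let $A$ be the integer matrix with the $3n$ columns $$A_{p,\tau_k(p)}=\epsilon_k+e_p+e_{\tau_k(p)}-e_{-\tau_i(p)}-e_{-\tau_j(p)} .$$ $M=\operatorname{im}A$ is the (rank $n+2$) lattice generated by the columns, and $\sigma^\vee\subset M_{\mathbb R}=M\otimes\mathbb R$ is the cone generated by the columns. $\tilde\Delta=\{x\in\sigma^\vee:\langle\epsilon_1^*+\epsilon_2^*+\epsilon_3^*,x\rangle=1\}$.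 For each $k$, partition the set of type $k$ columns $\{A_{p,\tau_k(p)}:p\in\mathrm{vert}\,T\}$ into orbits under translation by $\tau_k$ (i.e. $A_{p,\tau_k(p)}\mapsto A_{\tau_k(p),2\tau_k(p)}$); altogether this gives the $r$ cells $o_1,\dots,o_r$. For $p\in\mathrm{vert}\,T$ let $m_p=\sum_{k=1}^3(e_{\tau_k(p)}-e_{-\tau_k(p)})$; one has $m_p=A_{p,\tau_k(p)}-A_{-\tau_k(p),p}\in M$ for every $k$. $M''\subset M$ is the sublattice spanned by the $m_p$. Cayley cone: for lattice polytopes $\Delta_1,\dots,\Delta_r\subset\Lambda_{\mathbb R}$ ($\Lambda$ a lattice), the associated Cayley cone is $\{(\lambda_1,\dots,\lambda_r,\lambda_1x_1+\dots+\lambda_rx_r):\lambda_i\ge0,\ x_i\in\Delta_i\}\subset\mathbb R^r\oplus\Lambda_{\mathbb R}$ with lattice $\mathbb Z^r\oplus\Lambda$. *)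

(* Defs.v *)
From HB Require Import structures.
From mathcomp Require Import all_boot all_order all_algebra.
From mathcomp Require Import generic_quotient ring_quotient.
From mathcomp Require Import all_classical all_reals.

Set Implicit Arguments.
Unset Strict Implicit.
Unset Printing Implicit Defensive.

Import Order.TTheory GRing.Theory Num.Theory.

Local Open Scope classical_set_scope.
Local Open Scope quotient_scope.
Local Open Scope ring_scope.

Section IntegerSpan.
Variables (U : zmodType) (S : set U).

Definition zspan : {pred U} :=
  fun x => x \in smallest [set A : set U | zmod_closed [in A]] S.

Lemma zspan_closed : zmod_closed zspan.
Proof.
split=> [|x y /set_mem Sx /set_mem Sy]; apply/mem_set => A hA.
  by case: hA => -[/set_mem].
have [[_ AB] _] := hA; apply/set_mem/AB; apply/mem_set; [exact: Sx|exact: Sy].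
Qed.
HB.instance Definition _ := GRing.isZmodClosed.Build U zspan zspan_closed.

Lemma mem_zspan x : S x -> x \in zspan.
Proof. by move=> Sx; apply/mem_set => A [_]; apply. Qed.

Record lattice := Lattice { lattice_val :> U; _ : lattice_val \in zspan }.
HB.instance Definition _ := [isSub for lattice_val].
HB.instance Definition _ := [Choice of lattice by <:].
HB.instance Definition _ := [SubChoice_isSubZmodule of lattice by <:].

End IntegerSpan.

Section RealSpan.
Variables (R : realType) (W : lmodType R) (S : set W).

Definition rspan : {pred W} :=
  fun x => x \in smallest [set A : set W | submod_closed [in A]] S.

Lemma rspan_closed : submod_closed rspan.
Proof.
split=> [|a x y /set_mem Sx /set_mem Sy]; apply/mem_set => A hA.
  by case: hA => -[/set_mem].
have [[_ AB] _] := hA; apply/set_mem/AB; apply/mem_set; [exact: Sx|exact: Sy].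
Qed.
HB.instance Definition _ := GRing.isSubmodClosed.Build R W rspan rspan_closed.

Lemma mem_rspan x : S x -> x \in rspan.
Proof. by move=> Sx; apply/mem_set => A [_]; apply. Qed.

Record rspace := RSpace { rspace_val :> W; _ : rspace_val \in rspan }.
HB.instance Definition _ := [isSub for rspace_val].
HB.instance Definition _ := [Choice of rspace by <:].
HB.instance Definition _ := [SubChoice_isSubLmodule of rspace by <:].

End RealSpan.

(** If [f] embeds a lattice [U] in the real vector space [W = U (x) R], the
    real span of [f @` S] is [lattice S (x) R], and [base_change f S] is the
    inclusion of [lattice S] in it. *)
Section BaseChange.
Variables (R : realType) (U : zmodType) (W : lmodType R).
Variables (f : {additive U -> W}) (S : set U).

Lemma base_change_subproof (x : lattice S) :
  f (\val x) \in rspan (f @` S).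
Proof.
case: x => x /= /set_mem Sx.
pose B : set U := [set y | f y \in rspan (f @` S)].
suff: B x by [].
apply: Sx; split; last by move=> y Sy; apply: mem_rspan; exists y.
split=> [|y z /set_mem By /set_mem Bz]; apply/mem_set; rewrite /B /=.
  by rewrite raddf0 rpred0.
by rewrite raddfB rpredB.
Qed.

Definition base_change (x : lattice S) : rspace (f @` S) :=
  RSpace (base_change_subproof x).

Lemma base_change_is_zmod_morphism : zmod_morphism base_change.
Proof. by move=> x y; apply: val_inj; rewrite /= raddfB. Qed.
HB.instance Definition _ :=
  GRing.isZmodMorphism.Build (lattice S) (rspace (f @` S)) base_change
    base_change_is_zmod_morphism.

End BaseChange.

Arguments base_change {R U W} f S x.

Section Convex.
Variables (R : realType) (W : lmodType R).

Definition conv_hull (S : set W) : set W :=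
  [set x | exists (m : nat) (c : 'I_m -> R) (s : 'I_m -> W),
    [/\ forall i, 0 <= c i, \sum_i c i = 1, forall i, S (s i)
      & x = \sum_i c i *: s i]].

Definition conic_hull (S : set W) : set W :=
  [set x | exists (m : nat) (c : 'I_m -> R) (s : 'I_m -> W),
    [/\ forall i, 0 <= c i, forall i, S (s i) & x = \sum_i c i *: s i]].

Definition lattice_polytope (L : zmodType) (j : L -> W) (D : set W) : Prop :=
  exists A : set L, [/\ finite_set A, A !=set0 & D = conv_hull (j @` A)].

Definition cayley_cone (r : nat) (D : 'I_r -> set W) : set ('rV[R]_r * W) :=
  [set z | exists (c : 'I_r -> R) (x : 'I_r -> W),
    [/\ forall i, 0 <= c i, forall i, D i (x i)
      & z = (\row_i c i, \sum_i c i *: x i)]].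

End Convex.

Definition short_exact (A B C : zmodType)
    (f : {additive A -> B}) (g : {additive B -> C}) : Prop :=
  [/\ injective f, forall y, g y = 0 <-> exists x, f x = y
    & forall z, exists y, g y = z].

Definition is_order (V : zmodType) (x : V) (d : nat) : Prop :=
  (0 < d)%N /\ forall m : nat, x *+ m = 0 <-> (d %| m)%N.

Section Tessellation.
Variable R : realType.

(** The indices 1, 2, 3 of the tau_k are shifted to 0, 1, 2. *)
Definition tau_plane (k : 'I_3) : 'rV[R]_2 :=
  \row_j (if val k is k'.+1
          then if val j == 0%N then - 2^-1
               else (if k' == 0%N then 1 else -1) * (Num.sqrt 3 / 2)
          else (val j == 0%N)%:R).

Definition TT := lattice (range tau_plane).

Lemma tau_subproof k : tau_plane k \in zspan (range tau_plane).
Proof. by apply: mem_zspan; exists k. Qed.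

Definition tau (k : 'I_3) : TT := Lattice (tau_subproof k).

Lemma tau_sum0 : tau 0 + tau 1 + tau 2 = 0.
Proof.
apply: val_inj; apply/rowP => j; rewrite !mxE /=.
case: j => -[|[|//]] /= _; rewrite ?add0r; last by rewrite mul1r mulN1r subrr.
have h : 1 = 2^-1 + 2^-1 :> R by rewrite [LHS]splitr mul1r.
by rewrite {1}h addrK subrr.
Qed.

Definition adjacent (p q : TT) : Prop :=
  exists k, q = p + tau k \/ p = q + tau k.

(** A triangle is given by its vertex set. *)
Definition triangle (t : set TT) : Prop :=
  exists a b c, [/\ adjacent a b, adjacent b c, adjacent c a
                  & t = [set a; b; c]].

Variable Gamma : zmodClosed TT.

(** A subset of the torus R^2 / Gamma is represented by its preimage in R^2;
    this is the image in the torus of the convex hull of [t]. *)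
Definition torus_face (t : set TT) : set 'rV[R]_2 :=
  [set x | exists y g, [/\ conv_hull (\val @` t) y, g \in Gamma & x = y + \val g]].

(** [torus_face t <> torus_face t'] says that the two triangles of the torus are
    distinct. The proper subsets [s] of [t] and [s'] of [t'] range over the empty face,
    the vertices and the edges. *)
Definition polyhedral : Prop :=
  forall t t', triangle t -> triangle t' -> torus_face t <> torus_face t' ->
  exists s s', [/\ s `<` t, s' `<` t',
    torus_face t `&` torus_face t' = torus_face s
    & torus_face t `&` torus_face t' = torus_face s'].

Definition vert := {ideal_quot Gamma}.
Definition tauV (k : 'I_3) : vert := \pi_vert (tau k).

Lemma tauV_sum0 : tauV 0 + tauV 1 + tauV 2 = 0.
Proof. by rewrite /tauV !piE tau_sum0. Qed.

End Tessellation.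

(** What follows depends on [Gamma] only through the group [V = TT / Gamma] of
    vertices and the classes [t k] of the [tau k] in it. *)

Section TorusLattices.
Variables (R : realType) (V : zmodType) (t : 'I_3 -> V).
Hypothesis t_sum0 : t 0 + t 1 + t 2 = 0.

(** In Z/3 the third index besides [k] and [l] is [- (k + l)]. *)
Lemma t_third k l : l != k -> t (- (k + l)) = - t k - t l.
Proof.
move=> lk; suff H : t k + t l + t (- (k + l)) = 0.
  by rewrite -opprD; apply/eqP; rewrite -addr_eq0 addrC H.
have t3 (i j h : 'I_3) : val i = 0%N -> val j = 1%N -> val h = 2%N ->
    t i + t j + t h = 0.
  by move=> i0 j1 h2; rewrite -t_sum0; do 2?congr (_ + _); congr t;
    apply: val_inj.
case: k l lk => [[|[|[|//]]] hk] [[|[|[|//]]] hl] //= _.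
- exact: t3.
- by rewrite addrAC; exact: t3.
- by rewrite (addrC (t (Ordinal hk))); exact: t3.
- by rewrite addrC addrA; exact: t3.
- by rewrite -addrA addrC; exact: t3.
- by rewrite addrC (addrC (t (Ordinal hk))) addrA; exact: t3.
Qed.

Definition ambient := (('I_3 -> int) * (V -> int))%type.
Definition ambientR := (('I_3 -> R^o) * (V -> R^o))%type.

Definition eps (k : 'I_3) : ambient := (fun l => (l == k)%:Z, 0).
Definition e (p : V) : ambient := (0, fun q => (q == p)%:Z).

(** The column A_{p, tau_k(p)}. *)
Definition Acol_vec (k : 'I_3) (p : V) : ambient :=
  eps k + e p + e (p + t k) - \sum_(l < 3 | l != k) e (p - t l).

Definition m_vec (p : V) : ambient :=
  \sum_(k < 3) (e (p + t k) - e (p - t k)).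

Definition columns : set ambient := [set x | exists k p, x = Acol_vec k p].

Definition M := lattice columns.

Lemma Acol_subproof k p : Acol_vec k p \in zspan columns.
Proof. by apply: mem_zspan; exists k, p. Qed.

Definition Acol (k : 'I_3) (p : V) : M := Lattice (Acol_subproof k p).

Lemma m_vecE k p : m_vec p = Acol_vec k p - Acol_vec k (p - t k).
Proof.
have swap (U : zmodType) (y f s g v : U) :
    f + s - (g + v) = y + f - v - (y + g - s).
  rewrite opprB [RHS]addrACA -opprD (addrC v) -(addrA y f) -(addrA y g).
  by rewrite [in RHS]opprD [RHS]addrACA subrr add0r.
have rearrange (U : zmodType) (x c : U) (f g : 'I_3 -> U) :
    \sum_l (f l - g l) = x + c + f k - \sum_(l < 3 | l != k) g l
                       - (x + g k + c - \sum_(l < 3 | l != k) f l).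
  rewrite sumrB [\sum_l f l](bigD1 k) // [\sum_l g l](bigD1 k) // (addrAC x _ c).
  exact: swap.
have hK : involutive (fun l => - (k + l)) by move=> l; rewrite opprD opprK addKr.
have reorder : \sum_(l < 3 | l != k) e (p - t k - t l) =
               \sum_(l < 3 | l != k) e (p + t l).
  rewrite [RHS](reindex_inj (inv_inj hK)) /=; apply: eq_big => [l|l lk].
    by case: k l {rearrange hK} => [[|[|[|//]]] ?] [[|[|[|//]]] ?].
  by rewrite t_third // addrA.
rewrite /Acol_vec reorder subrK.
exact: (rearrange _ (eps k) (e p) (fun l => e (p + t l))).
Qed.

Lemma m_subproof p : m_vec p \in zspan columns.
Proof. by rewrite (m_vecE 0) rpredB ?Acol_subproof. Qed.

Definition m (p : V) : M := Lattice (m_subproof p).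

Definition M'' := lattice (range m).
Definition M_incl (x : M'') : M := \val x.

Lemma M_incl_is_zmod_morphism : zmod_morphism M_incl.
Proof. by move=> x y. Qed.
HB.instance Definition _ :=
  GRing.isZmodMorphism.Build M'' M M_incl M_incl_is_zmod_morphism.

Definition real_vec (x : ambient) : ambientR :=
  (fun k => (x.1 k)%:~R, fun p => (x.2 p)%:~R).

Lemma real_vec_is_zmod_morphism : zmod_morphism real_vec.
Proof.
by move=> x y; congr pair; apply/funext => k; exact: rmorphB.
Qed.
HB.instance Definition _ :=
  GRing.isZmodMorphism.Build ambient ambientR real_vec
    real_vec_is_zmod_morphism.

Definition MR := rspace (real_vec @` columns).
Definition toMR : {additive M -> MR} := base_change real_vec columns.

Definition MR'' := rspace (toMR @` range m).
Definition toMR'' : {additive M'' -> MR''} := base_change toMR (range m).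

Definition sigma_dual : set MR :=
  conic_hull (toMR @` [set x | exists k p, x = Acol k p]).

Definition Delta_tilde : set MR :=
  [set x | sigma_dual x /\ \sum_k (\val x).1 k = 1].

(** The orbit of A_{p, tau_k(p)} under translation by tau_k. *)
Definition cell (k : 'I_3) (p : V) : set M :=
  [set x | exists z : int, x = Acol k (p + t k *~ z)].

Definition cells : set (set M) := [set C | exists k p, C = cell k p].

(** A Cayley structure of length [r] on [sigma_dual] inducing the projection
    [pr]: a splitting M = Z^r (+) M'' with first component [pr] which, over
    the reals, turns [sigma_dual] into a Cayley cone. *)
Definition cayley_structure (r : nat) (pr : M -> 'rV[int]_r) : Prop :=
  exists (D : 'I_r -> set MR'') (psi : {additive M -> ('rV[int]_r * M'')%type})
         (psiR : {linear MR -> ('rV[R]_r * MR'')%type}),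
  [/\ forall i, lattice_polytope toMR'' (D i),
      bijective psi,
      forall x, (psi x).1 = pr x,
      forall x, psiR (toMR x) = (map_mx intr (psi x).1, toMR'' (psi x).2)
    & psiR @` sigma_dual = cayley_cone D].

End TorusLattices.

Arguments M {V} t.
Arguments Acol {V} t k p.
Arguments cell {V} t k p.
Arguments cells {V} t.
Arguments M'' {V t} t_sum0.
Arguments M_incl {V t} t_sum0 x.
Arguments MR R {V} t.
Arguments toMR R {V} t.
Arguments sigma_dual R {V} t.
Arguments Delta_tilde R {V} t.
Arguments cayley_structure R {V t} t_sum0 {r} pr.

(* Main.v *)
(** For each type [k], [V / <t k>] is cyclic of order [N], generated by the class of
    the next translation. A function [f] on [V] invariant under [t k] pairs to zero
    with the [V]-part of every column of the two other types, and with the [V]-part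
    of a column of type [k] to minus the discrete Laplacian of [f] on this cyclic
    group. The parabola [f x = x (x - N)] has constant Laplacian except at one
    point, so [2 eps_k^* + f] takes the value [2 N] on one cell and [0] on every
    other column. These functionals, divided by [2 N], give the projection to Z^r
    over the reals and over the integers at once, and choosing one column in each
    cell splits it. *)

From HB Require Import structures.
Require Import Defs.
From mathcomp Require Import all_boot all_order all_algebra.
From mathcomp Require Import generic_quotient ring_quotient.
From mathcomp Require Import all_classical all_reals.
From mathcomp Require Import zify ring.

Set Implicit Arguments.
Unset Strict Implicit.
Unset Printing Implicit Defensive.

Import Order.TTheory GRing.Theory Num.Theory.

Local Open Scope classical_set_scope.
Local Open Scope ring_scope.

(** * The cyclic quotient of a two-generator group, and a parabola on it *)

Section CyclicQuotient.
Variables (V : zmodType) (a b : V) (da db : nat).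
Hypothesis gen : forall p, exists y z : int, p = a *~ y + b *~ z.
Hypotheses (ord_a : is_order a da) (ord_b : is_order b db).

Definition in_cycle (p : V) : Prop := exists z : int, p = a *~ z.

Lemma in_cycleB p q : in_cycle p -> in_cycle q -> in_cycle (p - q).
Proof. by move=> [y ->] [z ->]; exists (y - z); rewrite mulrzBr. Qed.

Lemma in_cycleD p q : in_cycle p -> in_cycle q -> in_cycle (p + q).
Proof. by move=> [y ->] [z ->]; exists (y + z); rewrite mulrzDr. Qed.

Lemma in_cycleM p (z : int) : in_cycle p -> in_cycle (p *~ z).
Proof. by move=> [y ->]; exists (y * z); rewrite mulrzA. Qed.

Lemma period_subproof : exists x, (0 < x)%N && `[< in_cycle (b *+ x) >].
Proof.
have [db0 /(_ db)] := ord_b; rewrite dvdnn => -[_ /(_ isT) b0].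
by exists db; rewrite db0 b0; apply/asboolP; exists 0.
Qed.

(** The order of the class of [b] in V / <a>. By [gen] this class generates the quotient, so it is
    also the order of V / <a>. *)
Definition period : nat := ex_minn period_subproof.

Lemma period_gt0 : (0 < period)%N.
Proof. by rewrite /period; case: ex_minnP => x /andP[]. Qed.

Lemma in_cycle_period : in_cycle (b *+ period).
Proof. by rewrite /period; case: ex_minnP => x /andP[_ /asboolP]. Qed.

Lemma in_cycle_small x : (x < period)%N -> in_cycle (b *+ x) -> x = 0%N.
Proof.
rewrite /period; case: ex_minnP => N _ minN xN bx.
have [//|x0] := posnP x.
by move: xN; rewrite ltnNge minN // x0; apply/asboolP.
Qed.

(** The exponent of [b] can be reduced modulo [period]: the quotient part contributes a multiple of
    [b *+ period], which lies in <a>. *)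
Lemma pos_subproof p : exists x, (x < period)%N /\ in_cycle (p - b *+ x).
Proof.
have [y [z ->]] := gen p.
have N0 : period%:Z != 0 by rewrite eqz_nat -lt0n period_gt0.
have zN0 : 0 <= (z %% period)%Z by exact: modz_ge0.
exists `|(z %% period)%Z|%N; split.
  by rewrite -ltz_nat gez0_abs // ltz_pmod // ltz_nat period_gt0.
have -> : a *~ y + b *~ z - b *+ `|(z %% period)%Z|%N =
          a *~ y + (b *+ period) *~ (z %/ period)%Z.
  rewrite !pmulrn gez0_abs // -mulrzA -addrA -mulrzBr; congr (_ + b *~ _).
  by rewrite {1}(divz_eq z period) addrK mulrC.
by apply: in_cycleD; [exists y|exact/in_cycleM/in_cycle_period].
Qed.

(** The discrete logarithm to base [b] of the class of [p] in V / <a>. *)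
Definition pos (p : V) : nat := projT1 (cid (pos_subproof p)).

Lemma pos_lt p : (pos p < period)%N.
Proof. by rewrite /pos; case: cid => x []. Qed.

Lemma in_cycle_pos p : in_cycle (p - b *+ pos p).
Proof. by rewrite /pos; case: cid => x []. Qed.

(** The difference of two candidates is a number below [period] that carries [b] into <a>, hence
    zero by minimality. *)
Lemma pos_unique p x : (x < period)%N -> in_cycle (p - b *+ x) -> pos p = x.
Proof.
move=> xN px; have pN := pos_lt p; have pp := in_cycle_pos p.
have key u v : (u < period)%N -> in_cycle (p - b *+ u) ->
    in_cycle (p - b *+ v) -> (v <= u)%N -> u = v.
  move=> uN pu pv vu; apply/eqP; rewrite eqn_leq vu andbT -subn_eq0; apply/eqP.
  apply: in_cycle_small; first exact: leq_ltn_trans (leq_subr _ _) uN.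
  by have := in_cycleB pv pu; rewrite opprB addrC addrA subrK -mulrnBr.
by case: (leqP x (pos p)) => [/key|/ltnW/key/esym]; apply.
Qed.

Lemma pos_eq p q : pos p = pos q <-> in_cycle (p - q).
Proof.
split=> [pq|pq]; last first.
  apply: pos_unique (pos_lt q) _.
  by have := in_cycleD pq (in_cycle_pos q); rewrite addrA subrK.
have := in_cycleB (in_cycle_pos p) (in_cycle_pos q).
by rewrite pq opprB addrA subrK.
Qed.

Lemma pos_mulrn x : (x < period)%N -> pos (b *+ x) = x.
Proof. by move=> xN; apply: pos_unique => //; exists 0; rewrite subrr. Qed.

Lemma pos_eq0 p : pos p = 0%N <-> in_cycle p.
Proof. by rewrite -{1}(pos_mulrn period_gt0) mulr0n pos_eq subr0. Qed.

Lemma posDa p : pos (p + a) = pos p.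
Proof. by apply/pos_eq; exists 1; rewrite addrC addKr. Qed.

Lemma posDb p : pos (p + b) = if (pos p).+1 == period then 0%N else (pos p).+1.
Proof.
apply: pos_unique; first by case: eqP => [_|/eqP ne];
  [exact: period_gt0|rewrite ltn_neqAle ne pos_lt].
have := in_cycle_pos p; case: eqP => [e|_] pp.
  have := in_cycleD pp in_cycle_period; rewrite -e mulrSr addrA subrK.
  by rewrite mulr0n subr0.
by rewrite mulrSr opprD addrA -addrA [X in in_cycle X]addrACA subrr addr0.
Qed.

(* Its second difference along b is constant off <a>. *)
Definition parabola (p : V) : int := (pos p)%:Z * ((pos p)%:Z - period%:Z).

Lemma parabolaDa p : parabola (p + a) = parabola p.
Proof. by rewrite /parabola posDa. Qed.

(** The polynomial x (x - N) has second difference 2, and it vanishes at both 0 and N, so the wrap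
    from N - 1 to 0 is harmless for x > 0. At x = 0 both neighbours have the value 1 - N, which
    gives 2 (N - 1) + 2 = 2 N. *)
Lemma parabola_laplacian p :
  parabola p + parabola p - parabola (p - b) - parabola (p + b) + 2%:Z =
  if `[< in_cycle p >] then 2%:Z * period%:Z else 0.
Proof.
rewrite /parabola posDb.
have := posDb (p - b); rewrite subrK.
have := pos_lt (p - b); have := period_gt0.
have -> : `[< in_cycle p >] = (pos p == 0%N).
  by apply/asboolP/eqP => /pos_eq0.
move: (pos p) (pos (p - b)) period => x y N N0 yN.
(* With x and y the positions of [p] and [p - b]: either y + 1 = N and x = 0, where N = 1 is split
   off because then [p + b] also has position 0, or x = y + 1 and only [p + b] may wrap. *)
case: eqP => [<- -> /=|_ ->].
  case: eqP => [[<-]|_]; first by ring.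
  have -> : y.+1%:Z = y%:Z + 1 by lia.
  by ring.
have e1 : y.+1%:Z = y%:Z + 1 by lia.
have e2 : y.+2%:Z = y%:Z + 2 by lia.
case: eqP => [<-|_]; last by rewrite /= e2 e1; ring.
by rewrite /= e2 e1; ring.
Qed.

(** The elements x b + z a with x < [period] and z < [da] run through V exactly once, so n =
    [period] * [da]. *)
Lemma index_cycle n (en : 'I_n -> V) : bijective en -> period = (n %/ da)%N.
Proof.
move=> bij_en; have [da0 aE] := ord_a.
pose g (u : 'I_period * 'I_da) : V := b *+ u.1 + a *+ u.2.
have g_inj : injective g.
  move=> [x z] [x' z'] /= e; rewrite /g /= in e.
  have posg (u : 'I_period) (v : 'I_da) : pos (b *+ u + a *+ v) = u :> nat.
    rewrite -[RHS]pos_mulrn //; apply/pos_eq; exists v%:Z.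
    by rewrite addrAC subrr add0r pmulrn.
  have xx' : x = x' by apply: val_inj; rewrite /= -(posg x z) e posg.
  rewrite xx'; congr pair; apply: val_inj => /=.
  move: e; rewrite xx' => /addrI e.
  wlog le : z z' e / (z <= z')%N.
    by move=> H; case: (leqP z z') => [/H|/ltnW/H/esym]; apply.
  have /aE : a *+ (z' - z) = 0 by rewrite mulrnBr // e subrr.
  have lt : (z' - z < da)%N by exact: leq_ltn_trans (leq_subr _ _) (ltn_ord z').
  move=> dv; have : (z' - z == 0)%N.
    by apply: contraTT lt; rewrite -lt0n -leqNgt => /dvdn_leq; apply.
  by rewrite subn_eq0 => ge; apply/eqP; rewrite eqn_leq le.
have g_surj p : exists u, g u = p.
  have [z zE] := in_cycle_pos p.
  have N0 : da%:Z != 0 by rewrite eqz_nat -lt0n.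
  have zN0 : 0 <= (z %% da)%Z by exact: modz_ge0.
  have zlt : (`|(z %% da)%Z| < da)%N by rewrite -ltz_nat gez0_abs // ltz_pmod.
  exists (Ordinal (pos_lt p), Ordinal zlt); rewrite /g /=.
  rewrite [a *+ _]pmulrn gez0_abs //.
  have ada : a *+ da = 0 by apply/aE.
  have : a *~ z = a *~ (z %% da)%Z.
    by rewrite [in LHS](divz_eq z da) mulrzDr mulrC mulrzA -pmulrn ada mul0rz add0r.
  by move=> <-; rewrite -zE addrC subrK.
have [en' enK en'K] := bij_en.
pose h u := en' (g u).
have h_inj : injective h by move=> u v /(can_inj en'K)/g_inj.
have h_surj j : exists u, h u = j.
  by have [u uE] := g_surj (en j); exists u; rewrite /h uE enK.
have : #|{: 'I_period * 'I_da}| = #|'I_n|.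
  rewrite -(card_codom h_inj); apply: eq_card => j.
  by have [u <-] := h_surj j; rewrite codom_f.
by rewrite card_prod !card_ord => <-; rewrite mulnK.
Qed.

End CyclicQuotient.

(** * Induction on generators of integer and real spans *)

Section SpanInduction.
Variables (R : realType) (U : zmodType) (W : lmodType R).

(** Minimality of the span is a statement about subsets of [U], whereas [P] lives on the subtype. It
    is applied to those u that have some membership proof for which [P] holds; the choice of proof
    is irrelevant by [val_inj]. *)
Lemma lattice_gen_ind (S : set U) (P : lattice S -> Prop) :
  P 0 -> (forall x y, P x -> P y -> P (x - y)) ->
  (forall x, S (\val x) -> P x) -> forall x, P x.
Proof.
move=> P0 PB PS x.
pose A : set U := [set u | exists h : u \in zspan S, P (Lattice h)].
have /set_mem/(_ A) : \val x \in zspan S by exact: valP.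
case=> [|h]; last by congr P; apply: val_inj.
split; last first.
  by move=> u Su; exists (mem_zspan Su); apply: PS.
split=> [|u v /set_mem[hu Pu] /set_mem[hv Pv]]; apply/mem_set.
  by exists (rpred0 _); congr P: P0; apply: val_inj.
by exists (rpredB hu hv); congr P: (PB _ _ Pu Pv); apply: val_inj.
Qed.

Lemma rspace_gen_ind (S : set W) (P : rspace S -> Prop) :
  P 0 -> (forall a x y, P x -> P y -> P (a *: x + y)) ->
  (forall x, S (\val x) -> P x) -> forall x, P x.
Proof.
move=> P0 PD PS x.
pose A : set W := [set u | exists h : u \in rspan S, P (RSpace h)].
have /set_mem/(_ A) : \val x \in rspan S by exact: valP.
case=> [|h]; last by congr P; apply: val_inj.
split; last first.
  by move=> u Su; exists (mem_rspan Su); apply: PS.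
split=> [|a u v /set_mem[hu Pu] /set_mem[hv Pv]]; apply/mem_set.
  by exists (rpred0 _); congr P: P0; apply: val_inj.
have h : a *: u + v \in rspan S by rewrite rpredD ?rpredZ.
by exists h; congr P: (PD a _ _ Pu Pv); apply: val_inj.
Qed.

End SpanInduction.

Lemma sum_ord3_neq (U : zmodType) (g : 'I_3 -> U) k :
  \sum_(l < 3 | l != k) g l = g (k + 1) + g (k + 1 + 1).
Proof.
rewrite (bigD1 (k + 1)); last by case: k => -[|[|[|]]].
rewrite (bigD1 (k + 1 + 1)); last by case: k => -[|[|[|]]].
rewrite /= big1 ?addr0 // => l.
by case: k l => -[|[|[|//]]] ? [[|[|[|//]]] ?].
Qed.

(** * Linear functionals on the ambient space *)

Section Pairing.
Variables (R : realType) (V : zmodType) (n : nat) (en : 'I_n -> V).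
Hypothesis bij_en : bijective en.
Variables (c : 'I_3 -> R) (F : V -> R).

(** [V] carries no [finType] structure, so the sum over vertices goes through the enumeration
    [en]. *)
Definition pairing (x : ambientR R V) : R^o :=
  \sum_k c k * x.1 k + \sum_j F (en j) * x.2 (en j).

Lemma pairing_is_linear : linear pairing.
Proof.
move=> a x y; rewrite /pairing scalerDr addrACA !scaler_sumr -!big_split /=.
by congr (_ + _); apply: eq_bigr => i _; rewrite mulrDr mulrCA.
Qed.
HB.instance Definition _ :=
  GRing.isLinear.Build R (ambientR R V) R^o _ pairing pairing_is_linear.

Lemma pairing_eps k : pairing (real_vec R (eps V k)) = c k.
Proof.
rewrite /pairing /= [X in _ + X]big1 => [|j _]; last by rewrite mulr0.
rewrite addr0 (bigD1 k) //= eqxx mulr1 big1 ?addr0 // => l /negPf->.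
by rewrite mulr0.
Qed.

Lemma pairing_e p : pairing (real_vec R (e p)) = F p.
Proof.
have [en' enK en'K] := bij_en.
rewrite /pairing /= big1 => [|j _]; last by rewrite mulr0.
rewrite add0r (bigD1 (en' p)) //= en'K eqxx mulr1 big1 ?addr0 // => j.
by rewrite -(can_eq enK) en'K => /negPf->; rewrite mulr0.
Qed.

Lemma pairing_Acol (t : 'I_3 -> V) k p :
  pairing (real_vec R (Acol_vec t k p)) =
  c k + F p + F (p + t k) - F (p - t (k + 1)) - F (p - t (k + 1 + 1)).
Proof.
have pD x y : pairing (real_vec R (x + y)) =
    pairing (real_vec R x) + pairing (real_vec R y) by rewrite !raddfD.
have pB x y : pairing (real_vec R (x - y)) =
    pairing (real_vec R x) - pairing (real_vec R y) by rewrite !raddfB.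
by rewrite /Acol_vec sum_ord3_neq opprD addrA !(pB, pD) pairing_eps !pairing_e.
Qed.

End Pairing.

(** * Functionals separating the cells, and the number of cells *)

Section Torus.
Variables (R : realType) (V : zmodType) (t : 'I_3 -> V).
Hypothesis t_sum0 : t 0 + t 1 + t 2 = 0.
Variables (n : nat) (en : 'I_n -> V) (d : 'I_3 -> nat).
Hypothesis bij_en : bijective en.
Hypothesis ord_t : forall k, is_order (t k) (d k).
Hypothesis gen_t : forall k p, exists y z : int, p = t k *~ y + t (k + 1) *~ z.

Lemma t_succ2 k : t (k + 1 + 1) = - t k - t (k + 1).
Proof.
have kk : k + 1 != k by case: k => -[|[|[|//]]] ?.
have := t_third t_sum0 kk; rewrite -opprD => <-.
by congr t; case: k {kk} => -[|[|[|//]]] ?; apply: val_inj.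
Qed.

Lemma ord3_cycle (k : 'I_3) : k + 1 + 1 + 1 = k.
Proof. by case: k => -[|[|[|//]]] ?; apply: val_inj. Qed.

Lemma ord3_cases (k l : 'I_3) : [\/ l = k, l = k + 1 | l = k + 1 + 1].
Proof.
case: k l => -[|[|[|//]]] ? [[|[|[|//]]] ?];
  by [constructor 1; apply: val_inj | constructor 2; apply: val_inj
     | constructor 3; apply: val_inj].
Qed.


Definition nb_cells k : nat := period (t k) (ord_t (k + 1)).

(** This is 2 eps_k^* + f divided by 2 N, with the parabola f recentred so that its exceptional
    point is the class of [p0]. *)
Definition cell_functional k p0 : ambientR R V -> R^o :=
  pairing en (fun l => (l == k)%:R / (nb_cells k)%:R)
    (fun p => (parabola (gen_t k) (ord_t (k + 1)) (p - p0))%:~R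
              / (2 * (nb_cells k)%:R)).
HB.instance Definition _ k p0 := GRing.Linear.on (cell_functional k p0).

Lemma cell_functional_Acol k p0 l q :
  cell_functional k p0 (real_vec R (Acol_vec t l q)) =
  `[< l = k /\ in_cycle (t k) (q - p0) >]%:R.
Proof.
rewrite /cell_functional pairing_Acol //.
have N0 : (nb_cells k)%:R != 0 :> R.
  by rewrite pnatr_eq0 -lt0n; exact: period_gt0.
have lap := parabola_laplacian (gen_t k) (ord_t (k + 1)) (q - p0).
have parDa p : parabola (gen_t k) (ord_t (k + 1)) (p + t k) =
               parabola (gen_t k) (ord_t (k + 1)) p by exact: parabolaDa.
move: lap parDa; set f := parabola _ _ => lap fDa.
have fBa p : f (p - t k) = f p by rewrite -{2}(subrK (t k) p) fDa.
have [lk|lk|lk] := ord3_cases k l.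
(* Type k: as t_k + t_{k+1} = - t_{k+2} and f is invariant under t_k, the four vertex terms form the
   negative Laplacian of f along t_{k+1}. *)
- rewrite lk eqxx.
  have -> : q + t k - p0 = q - p0 + t k by rewrite addrAC.
  have -> : q - t (k + 1) - p0 = q - p0 - t (k + 1) by rewrite addrAC.
  have -> : q - t (k + 1 + 1) - p0 = q - p0 + t (k + 1) + t k.
    by rewrite t_succ2 opprB opprK addrA [LHS]addrAC (addrAC q (t _)).
  rewrite !fDa.
  move: lap => /(congr1 (fun z : int => z%:~R : R)).
  rewrite !(rmorphD, rmorphN) /= => lap.
  have -> : 1 / (nb_cells k)%:R + (f (q - p0))%:~R / (2 * (nb_cells k)%:R)
    + (f (q - p0))%:~R / (2 * (nb_cells k)%:R)
    - (f (q - p0 - t (k + 1)))%:~R / (2 * (nb_cells k)%:R)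
    - (f (q - p0 + t (k + 1)))%:~R / (2 * (nb_cells k)%:R)
   = ((f (q - p0))%:~R + (f (q - p0))%:~R - (f (q - p0 - t (k + 1)))%:~R
     - (f (q - p0 + t (k + 1)))%:~R + 2) / (2 * (nb_cells k)%:R) :> R by field.
  rewrite lap.
  have -> : `[< k = k /\ in_cycle (t k) (q - p0) >] =
            `[< in_cycle (t k) (q - p0) >].
    by apply: asbool_equiv_eq; split=> [[]|].
  case: ifP => _; last by rewrite mul0r.
  by rewrite rmorphM /= -pmulrn divff // mulf_neq0 // pnatr_eq0.
(* Type k + 1: modulo t_k, the point q + t_{k+1} agrees with q - t_{k+2}, and q with q - t_k, so the
   terms cancel in pairs. *)
- have lnk : l != k by rewrite lk; case: (k) => -[|[|[|//]]] ?.
  rewrite (negPf lnk) asboolF; last by case=> /eqP; rewrite (negPf lnk).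
  rewrite lk ord3_cycle.
  have -> : f (q - t (k + 1 + 1) - p0) = f (q + t (k + 1) - p0).
    rewrite -[RHS]fDa; congr f.
    by rewrite t_succ2 opprB opprK addrA [LHS]addrAC.
  have -> : f (q - t k - p0) = f (q - p0) by rewrite addrAC fBa.
  by rewrite /= mulr0n; field.
(* Type k + 2: the pairs are now q + t_{k+2} with q - t_{k+1}, and again q with q - t_k. *)
- have lnk : l != k by rewrite lk; case: (k) => -[|[|[|//]]] ?.
  rewrite (negPf lnk) asboolF; last by case=> /eqP; rewrite (negPf lnk).
  rewrite lk ord3_cycle.
  have -> : f (q + t (k + 1 + 1) - p0) = f (q - t (k + 1) - p0).
    rewrite -[RHS]fBa; congr f.
    by rewrite t_succ2 addrA (addrAC q) [LHS]addrAC.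
  have -> : f (q - t k - p0) = f (q - p0) by rewrite addrAC fBa.
  by rewrite /= mulr0n; field.
Qed.

(** An equality of column vectors is tested on a functional: the one attached to the cell of (k, p)
    is 1 on that whole cell, and being 1 on a column forces its type and its class modulo t_k. *)
Lemma cell_Acol k p l q :
  cell t k p (Acol t l q) <-> l = k /\ in_cycle (t k) (q - p).
Proof.
split=> [[z /(congr1 val)/= e]|[-> [z zE]]]; last first.
  by exists z; rewrite -zE addrC subrK.
have := cell_functional_Acol k p l q.
rewrite e cell_functional_Acol asboolT; last first.
  by split=> //; exists z; rewrite addrC addKr.
by move=> /eqP; case: asboolP => // _; rewrite oner_eq0.
Qed.

Lemma cell_eq k p l q : cell t k p (Acol t l q) -> cell t l q = cell t k p.
Proof.
move=> /cell_Acol[-> [z zE]].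
have -> : q = p + t k *~ z by rewrite -zE addrC subrK.
apply/seteqP; split=> x [y ->].
  by exists (z + y); rewrite mulrzDr addrA.
by exists (y - z); rewrite mulrzBr addrACA subrr addr0.
Qed.

Lemma cell_self k p : cell t k p (Acol t k p).
Proof. by apply/cell_Acol; split=> //; exists 0; rewrite subrr. Qed.

(** The cells of type k correspond to the elements of V / <t_k>, represented by the first
    [nb_cells k] multiples of t_{k+1}. *)
Lemma card_cells : (cells t #= `I_(\sum_(k < 3) n %/ d k)%N)%card.
Proof.
pose T := {k : 'I_3 & 'I_(nb_cells k)}.
pose g (u : T) : set (M t) := cell t (tag u) (t (tag u + 1) *+ tagged u).
have g_inj : injective g.
  move=> [k x] [l y]; rewrite /g /= => e.
  have := cell_self k (t (k + 1) *+ x); rewrite e => /cell_Acol[kl].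
  case: l / kl y e => y e xy; congr existT; apply: val_inj => /=.
  have := pos_eq (gen_t k) (ord_t (k + 1)) (t (k + 1) *+ x) (t (k + 1) *+ y).
  by rewrite !pos_mulrn // => -[_]; apply.
have -> : cells t = range g.
  apply/seteqP; split=> [_ [k [p ->]]|_ [u _ <-]]; last by do 2 eexists.
  have := in_cycle_pos (gen_t k) (ord_t (k + 1)) p.
  have := pos_lt (gen_t k) (ord_t (k + 1)) p.
  set x := pos _ _ _ => xN xp.
  exists (Tagged (fun k => 'I_(nb_cells k)) (Ordinal xN)) => //.
  by rewrite /g /=; apply/esym/cell_eq/cell_Acol.
have cT : #|{: T}| = (\sum_(k < 3) n %/ d k)%N.
  rewrite card_tagged sumnE big_map big_enum /=; apply: eq_bigr => k _.
  by rewrite card_ord; exact: (index_cycle (gen_t k) (ord_t k) (ord_t (k + 1)) bij_en).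
rewrite -cT; apply: card_eq_trans (card_esym card_II).
pose h (x : 'I_#|{: T}|) : set (M t) := g (enum_val x).
have h_inj : {in [set: 'I_#|{: T}|]  &, injective h}.
  by move=> x y _ _ /g_inj/enum_val_inj.
have -> : range g = range h.
  apply/seteqP; split=> _ [u _ <-]; last by exists (enum_val u).
  by exists (enum_rank u) => //; rewrite /h enum_rankK.
exact: inj_card_eq h_inj.
Qed.

End Torus.

(** * Conic and convex hulls *)

Section Hulls.
Variables (R : realType) (W : lmodType R) (S : set W).

Lemma conic_hull0 : conic_hull S 0.
Proof.
exists 0%N, (fun=> 0), (fun=> 0).
by split=> [[]//|[]//|]; rewrite big_ord0.
Qed.

Lemma conic_hullD x y : conic_hull S x -> conic_hull S y -> conic_hull S (x + y).
Proof.
move=> [p [c [s [c0 sS ->]]]] [q [c' [s' [c'0 s'S ->]]]].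
pose glue T (f : 'I_p -> T) (g : 'I_q -> T) i :=
  match fintype.split i with inl j => f j | inr j => g j end.
exists (p + q)%N, (glue R c c'), (glue W s s'); rewrite /glue.
split=> [i|i|]; [by case: fintype.split|by case: fintype.split|].
rewrite big_split_ord /=; congr (_ + _); apply: eq_bigr => i _.
  by rewrite (unsplitK (inl i : 'I_p + 'I_q)%type).
by rewrite (unsplitK (inr i : 'I_p + 'I_q)%type).
Qed.

Lemma conic_hull_sum (I : finType) (x : I -> W) :
  (forall i, conic_hull S (x i)) -> conic_hull S (\sum_i x i).
Proof.
move=> xS; apply: big_ind => [|y z|i _]; last exact: xS.
- exact: conic_hull0.
- exact: conic_hullD.
Qed.

Lemma conv_hull_sub w : S w -> conv_hull S w.
Proof.
move=> Sw; exists 1%N, (fun=> 1), (fun=> w).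
by split; rewrite ?big_ord1 ?scale1r.
Qed.

(* A nonnegative combination is its total weight times a barycenter; when the
   weight vanishes, any point of S serves as the barycenter. *)
Lemma conv_hull_barycenter p (P : pred 'I_p) (c : 'I_p -> R) (s : 'I_p -> W) :
  S !=set0 -> (forall j, 0 <= c j) -> (forall j, P j -> S (s j)) ->
  exists2 x, conv_hull S x &
    \sum_(j | P j) c j *: s j = (\sum_(j | P j) c j) *: x.
Proof.
move=> [w Sw] c0 sS; set C := \sum_(j | P j) c j.
have C0 : 0 <= C by apply: sumr_ge0.
have [CE|CN] := eqVneq C 0.
  exists w; first exact: conv_hull_sub.
  rewrite CE scale0r big1 // => j Pj.
  have /eqP := CE; rewrite /C psumr_eq0 // => /allP/(_ j).
  by rewrite mem_index_enum Pj => /(_ isT)/eqP->; rewrite scale0r.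
exists (C^-1 *: \sum_(j | P j) c j *: s j); last by rewrite scalerA divff ?scale1r.
(* Indices outside [P] get weight 0 and the dummy point [w], since every listed point must lie in
   [S]. *)
exists p, (fun j => if P j then C^-1 * c j else 0), (fun j => if P j then s j else w).
split=> [j||j|]; first by case: ifP => // _; rewrite mulr_ge0 ?invr_ge0.
- by rewrite -big_mkcond /= -mulr_sumr mulVf.
- by case: ifP => // /sS.
- rewrite scaler_sumr big_mkcond /=; apply: eq_bigr => j _.
  by case: ifP; rewrite ?scale0r ?scalerA.
Qed.

End Hulls.

(** * The projection to Z^r, its splitting, and the Cayley structure *)

Section CellProjection.
Variables (R : realType) (V : zmodType) (t : 'I_3 -> V).
Hypothesis t_sum0 : t 0 + t 1 + t 2 = 0.
Hypothesis finV : finite_set [set: V].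
Variables (r : nat) (o : 'I_r -> set (M t)) (F : 'I_r -> {linear ambientR R V -> R^o}).
Hypothesis o_cell : forall i, exists k p, o i = cell t k p.
Hypothesis o_cover : forall k p, exists i, o i (Acol t k p).
Hypothesis o_inj : forall k p i j, o i (Acol t k p) -> o j (Acol t k p) -> i = j.
Hypothesis o_stable : forall i k p, o i (Acol t k p) -> o i (Acol t k (p - t k)).
Hypothesis F_Acol : forall i k p,
  F i (real_vec R (Acol_vec t k p)) = `[< o i (Acol t k p) >]%:R.

Lemma F_cell i j k p : o j (Acol t k p) ->
  F i (real_vec R (Acol_vec t k p)) = (j == i)%:R.
Proof.
move=> oj; rewrite F_Acol; congr (nat_of_bool _)%:R.
by apply/asboolP/eqP => [oi|<-//]; exact: o_inj oj oi.
Qed.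

Definition prR (x : MR R t) : 'rV[R]_r := \row_i F i (\val x).

Lemma prR_is_linear : linear prR.
Proof. by move=> a x y; apply/rowP => i; rewrite !mxE !linearP. Qed.
HB.instance Definition _ :=
  GRing.isLinear.Build R (MR R t) 'rV[R]_r _ prR prR_is_linear.

Lemma F_int i (x : M t) : F i (real_vec R (\val x)) \is a Num.int.
Proof.
elim/lattice_gen_ind: x => [|x y|x [k [p ->]]].
- by rewrite !raddf0 rpred0.
- by rewrite !raddfB; exact: rpredB.
- by rewrite F_Acol; case: asbool.
Qed.

(** The functionals are 0 or 1 on columns, hence integral on [M] by [F_int]. So [Num.floor] changes
    only the type of the coordinates, and additivity is inherited from [prR]. *)
Definition pr (x : M t) : 'rV[int]_r :=
  \row_i Num.floor (F i (real_vec R (\val x)) : R).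

Lemma prR_toMR x : prR (toMR R t x) = map_mx intr (pr x).
Proof. by apply/rowP => i; rewrite !mxE floorK ?F_int. Qed.

Lemma map_mx_intr_inj : injective (map_mx intr : 'rV[int]_r -> 'rV[R]_r).
Proof.
move=> u v /rowP uv; apply/rowP => i.
by have := uv i; rewrite !mxE => /intr_inj.
Qed.

Lemma pr_is_zmod_morphism : zmod_morphism pr.
Proof.
move=> x y; apply: map_mx_intr_inj.
by rewrite raddfB /= -!prR_toMR !raddfB.
Qed.
HB.instance Definition _ :=
  GRing.isZmodMorphism.Build (M t) 'rV[int]_r pr pr_is_zmod_morphism.

Lemma prR_Acol i k p : o i (Acol t k p) ->
  prR (toMR R t (Acol t k p)) = delta_mx 0 i.
Proof.
by move=> oi; apply/rowP => j; rewrite !mxE /= (F_cell _ oi) eq_sym.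
Qed.

Lemma pr_Acol i k p : o i (Acol t k p) -> pr (Acol t k p) = delta_mx 0 i.
Proof.
move=> oi; apply: map_mx_intr_inj; rewrite -prR_toMR (prR_Acol oi).
by rewrite map_delta_mx.
Qed.

Lemma m_AcolB k p : m t_sum0 p = Acol t k p - Acol t k (p - t k).
Proof. by apply: val_inj; rewrite /= (m_vecE t_sum0 k). Qed.

Lemma m_in_zspan p : m t_sum0 p \in zspan (range (m t_sum0)).
Proof. by apply: mem_zspan; exists p. Qed.

(** Consecutive columns of an orbit differ by some m_q, so the difference telescopes, upwards or
    downwards according to the sign of [z]. *)
Lemma Acol_sub_cell k p (z : int) :
  Acol t k (p + t k *~ z) - Acol t k p \in zspan (range (m t_sum0)).
Proof.
elim: z => [|z IH|z IH]; first by rewrite mulr0z addr0 subrr rpred0.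
  have e : p + t k *~ z.+1 - t k = p + t k *~ z.
    by rewrite intS mulrzDr mulr1z (addrC (t k)) addrA addrK.
  have := rpredD (m_in_zspan (p + t k *~ z.+1)) IH.
  by rewrite (m_AcolB k) e addrA subrK.
have e : p + t k *~ - z%:Z - t k = p + t k *~ - z.+1%:Z.
  by rewrite intS opprD mulrzDr mulrN1z -addrA (addrC (t k *~ _)).
have := rpredB IH (m_in_zspan (p + t k *~ - z%:Z)).
by rewrite (m_AcolB k) e opprB addrC addrA subrK.
Qed.

Lemma rep_subproof i : exists u : 'I_3 * V, o i = cell t u.1 u.2.
Proof. by have [k [p ->]] := o_cell i; exists (k, p). Qed.

Definition rep i : M t :=
  let u := projT1 (cid (rep_subproof i)) in Acol t u.1 u.2.

Lemma repP i : exists k p, [/\ rep i = Acol t k p, o i (Acol t k p)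
  & forall x, o i x -> exists z : int, x = Acol t k (p + t k *~ z)].
Proof.
rewrite /rep; case: cid => -[k p] /= ->; exists k, p; split=> //.
by exists 0; rewrite addr0.
Qed.

Lemma pr_rep i : pr (rep i) = delta_mx 0 i.
Proof. by have [k [p [-> /pr_Acol->]]] := repP i. Qed.

(** The splitting that lifts each basis vector to the chosen column of its cell. *)
Definition sect (v : 'rV[int]_r) : M t := \sum_i rep i *~ v 0 i.

Lemma sect_is_zmod_morphism : zmod_morphism sect.
Proof.
by move=> u v; rewrite -sumrB; apply: eq_bigr => i _; rewrite !mxE mulrzBr.
Qed.
HB.instance Definition _ :=
  GRing.isZmodMorphism.Build 'rV[int]_r (M t) sect sect_is_zmod_morphism.

Lemma sect_delta i : sect (delta_mx 0 i) = rep i.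
Proof.
rewrite /sect (bigD1 i) //= big1 => [|j ji]; rewrite !mxE /=.
  by rewrite !eqxx addr0 mulr1z.
by rewrite (negPf ji) mulr0z.
Qed.

Lemma sectK : cancel sect pr.
Proof.
move=> v; rewrite raddf_sum [RHS]row_sum_delta; apply: eq_bigr => i _.
by rewrite raddfMz /= pr_rep -scaler_int intz.
Qed.

(** For a column, [sect (pr x)] is the chosen column of the same cell, and columns of one cell
    differ by elements of [M'']. This yields the inclusion of the kernel of [pr] in [M'']. *)
Lemma ret_subproof x : x - sect (pr x) \in zspan (range (m t_sum0)).
Proof.
elim/lattice_gen_ind: x => [|x y Px Py|x [k [p xE]]].
- by rewrite !raddf0 addr0 rpred0.
- have -> : x - y - sect (pr (x - y)) = x - sect (pr x) - (y - sect (pr y)).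
    by rewrite !raddfB /= addrACA -opprD.
  exact: rpredB.
- have -> : x = Acol t k p by apply: val_inj.
  have [i oi] := o_cover k p.
  rewrite (pr_Acol oi) sect_delta.
  have [l [q [-> _ /(_ _ oi)[z ->]]]] := repP i.
  exact: Acol_sub_cell.
Qed.

Definition ret (x : M t) : M'' t_sum0 := Lattice (ret_subproof x).

Lemma ret_is_zmod_morphism : zmod_morphism ret.
Proof.
by move=> x y; apply: val_inj; rewrite /= !raddfB /= addrACA -opprD.
Qed.
HB.instance Definition _ :=
  GRing.isZmodMorphism.Build (M t) (M'' t_sum0) ret ret_is_zmod_morphism.

(** Each generator m_p is a difference of two columns of the same cell, by [o_stable]. *)
Lemma pr_M_incl y : pr (M_incl t_sum0 y) = 0.
Proof.
elim/lattice_gen_ind: y => [|x y Px Py|x [p _ pE]].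
- by rewrite !raddf0.
- have -> : pr (M_incl t_sum0 (x - y)) =
            pr (M_incl t_sum0 x) - pr (M_incl t_sum0 y) by rewrite !raddfB.
  by rewrite Px Py subrr.
- have -> : M_incl t_sum0 x = m t_sum0 p by exact: esym.
  have [i oi] := o_cover 0 p.
  by rewrite (m_AcolB 0) raddfB /= (pr_Acol oi) (pr_Acol (o_stable oi)) subrr.
Qed.

Lemma exact_pr : short_exact (M_incl t_sum0) pr.
Proof.
split=> [x y|y|v]; first exact: val_inj.
- split=> [py|[x <-]]; last exact: pr_M_incl.
  (* On the kernel of [pr] the retraction [ret] does not move [y]. *)
  have yE : y - sect (pr y) = y by rewrite [pr y]py raddf0 subr0.
  by exists (ret y).
- by exists (sect v); exact: sectK.
Qed.

Definition psi (x : M t) : 'rV[int]_r * M'' t_sum0 := (pr x, ret x).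

Lemma psi_is_zmod_morphism : zmod_morphism psi.
Proof. by move=> x y; rewrite /psi !raddfB. Qed.
HB.instance Definition _ :=
  GRing.isZmodMorphism.Build (M t) ('rV[int]_r * M'' t_sum0)%type psi
    psi_is_zmod_morphism.

Lemma psi_bij : bijective psi.
Proof.
exists (fun u => sect u.1 + M_incl t_sum0 u.2) => [x|[v y]].
  by rewrite /= addrC subrK.
have prE : pr (sect v + M_incl t_sum0 y) = v.
  by rewrite raddfD /= sectK pr_M_incl addr0.
rewrite /psi /= prE; congr pair; apply: val_inj.
by rewrite /= prE addrC addKr.
Qed.

Definition sectR (v : 'rV[R]_r) : MR R t := \sum_i v 0 i *: toMR R t (rep i).

Lemma sectR_is_linear : linear sectR.
Proof.
move=> a u v; rewrite scaler_sumr -big_split; apply: eq_bigr => i _.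
by rewrite !mxE scalerDl scalerA.
Qed.
HB.instance Definition _ :=
  GRing.isLinear.Build R 'rV[R]_r (MR R t) _ sectR sectR_is_linear.

Lemma toMR_sect v : toMR R t (sect v) = sectR (map_mx intr v).
Proof.
rewrite raddf_sum; apply: eq_bigr => i _.
by rewrite mxE scaler_int raddfMz.
Qed.

Lemma toMR_ret x :
  toMR R t x - sectR (prR (toMR R t x)) = \val (toMR'' R t_sum0 (ret x)).
Proof. by rewrite prR_toMR -toMR_sect -raddfB. Qed.

(** By linearity it suffices to treat columns, where the real retraction is the image of the
    integral one. *)
Lemma retR_subproof x :
  x - sectR (prR x) \in rspan (toMR R t @` range (m t_sum0)).
Proof.
elim/rspace_gen_ind: x => [|a x y Px Py|x [_ [k [p ->]] xE]].
- by rewrite !raddf0 addr0 rpred0.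
- have -> : a *: x + y - sectR (prR (a *: x + y)) =
      a *: (x - sectR (prR x)) + (y - sectR (prR y)).
    have -> : sectR (prR (a *: x + y)) = a *: sectR (prR x) + sectR (prR y).
      by rewrite !linearP.
    by rewrite opprD addrACA scalerBr.
  by rewrite rpredD ?rpredZ.
- have -> : x = toMR R t (Acol t k p) by apply: val_inj; rewrite -xE.
  by rewrite toMR_ret; exact: valP.
Qed.

Definition retR (x : MR R t) : MR'' R t_sum0 := RSpace (retR_subproof x).

Lemma retR_toMR x : retR (toMR R t x) = toMR'' R t_sum0 (ret x).
Proof. by apply: val_inj; rewrite -toMR_ret. Qed.

Lemma retR_is_linear : linear retR.
Proof.
move=> a x y; apply: val_inj => /=.
have -> : sectR (prR (a *: x + y)) = a *: sectR (prR x) + sectR (prR y).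
  by rewrite !linearP.
by rewrite opprD addrACA scalerBr.
Qed.
HB.instance Definition _ :=
  GRing.isLinear.Build R (MR R t) (MR'' R t_sum0) _ retR retR_is_linear.

Definition psiR (x : MR R t) : 'rV[R]_r * MR'' R t_sum0 := (prR x, retR x).

Lemma psiR_is_linear : linear psiR.
Proof. by move=> a x y; rewrite /psiR !linearP. Qed.
HB.instance Definition _ :=
  GRing.isLinear.Build R (MR R t) ('rV[R]_r * MR'' R t_sum0)%type _ psiR
    psiR_is_linear.

Lemma psiR_Acol i k p : o i (Acol t k p) ->
  psiR (toMR R t (Acol t k p)) =
  (delta_mx 0 i, toMR'' R t_sum0 (ret (Acol t k p))).
Proof. by move=> oi; rewrite /psiR (prR_Acol oi) retR_toMR. Qed.

(** The lattice points whose hull is the i-th Cayley polytope: the columns of [o i], measured from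
    the chosen column of that cell. *)
Definition fiber i : set (M'' t_sum0) :=
  [set y | exists k p, o i (Acol t k p) /\ y = ret (Acol t k p)].

Definition cell_polytope i : set (MR'' R t_sum0) :=
  conv_hull (toMR'' R t_sum0 @` fiber i).

Lemma fiber_neq0 i : fiber i !=set0.
Proof. by have [k [p [_ oi _]]] := repP i; exists (ret (Acol t k p)), k, p. Qed.

Lemma cell_polytopeP i : lattice_polytope (toMR'' R t_sum0) (cell_polytope i).
Proof.
exists (fiber i); split=> //; last exact: fiber_neq0.
have [k [q [_ _ oE]]] := repP i.
(* All columns of a cell have one type k, so the fiber is covered by the image of the finite set
   V. *)
apply: (@sub_finite_set _ _ ((fun p => ret (Acol t k p)) @` setT)).
  move=> _ [l [p [oi ->]]]; have [z ->] := oE _ oi.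
  by exists (q + t k *~ z).
exact: finite_image.
Qed.

(** From left to right, the terms of a nonnegative combination of columns are grouped by cell, and
    each group is replaced by its total weight times a barycenter. From right to left, each c_i x_i
    is expanded into points of the fiber, and these are lifted back to columns. *)
Lemma psiR_sigma : psiR @` sigma_dual R t = cayley_cone cell_polytope.
Proof.
apply/seteqP; split.
  move=> _ [_ [p [c [s [c0 sS ->]]]] <-].
  (* Each term is recorded with its type, its vertex and the index of its cell. *)
  have /choice[u uP] : forall j, exists u : 'I_3 * V * 'I_r,
      o u.2 (Acol t u.1.1 u.1.2) /\ s j = toMR R t (Acol t u.1.1 u.1.2).
    move=> j; have [_ [k [q ->]] <-] := sS j.
    by have [i oi] := o_cover k q; exists (k, q, i).
  pose y j := ret (Acol t (u j).1.1 (u j).1.2).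
  pose C i := \sum_(j | (u j).2 == i) c j.
  have /choice[x xP] : forall i, exists x, cell_polytope i x /\
      \sum_(j | (u j).2 == i) c j *: toMR'' R t_sum0 (y j) = C i *: x.
    move=> i; have [||//|x xD xE] := @conv_hull_barycenter R _
      (toMR'' R t_sum0 @` fiber i) p (fun j => (u j).2 == i) c
      (fun j => toMR'' R t_sum0 (y j)); last by exists x.
    - by have [w iw] := fiber_neq0 i; exists (toMR'' R t_sum0 w), w.
    - exact: c0.
    - move=> j /eqP <-; exists (y j) => //.
      by have [oj _] := uP j; do 2 eexists; split; first exact: oj.
  exists C, x; split=> [i|i|].
  - by apply: sumr_ge0.
  - by have [] := xP i.
  rewrite raddf_sum.
  have -> : \sum_j psiR (c j *: s j) =
      \sum_j (c j *: delta_mx 0 (u j).2, c j *: toMR'' R t_sum0 (y j)).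
    apply: eq_bigr => j _; have [oj ->] := uP j.
    by rewrite linearZ /= (psiR_Acol oj).
  rewrite [LHS]surjective_pairing; congr pair.
    rewrite raddf_sum /=; apply/rowP => i; rewrite summxE mxE [RHS]big_mkcond.
    apply: eq_bigr => j _; rewrite !mxE eqxx /= eq_sym.
    by case: eqP; rewrite ?mulr1 ?mulr0.
  rewrite raddf_sum /= (partition_big (fun j => (u j).2) predT) //=.
  by apply: eq_bigr => i _; have [_ <-] := xP i.
move=> _ [c [x [c0 xD ->]]].
have /choice[y yP] : forall i, exists y, sigma_dual R t y /\
    psiR y = (c i *: delta_mx 0 i, c i *: x i).
  move=> i; have [p [b [s [b0 b1 sS ->]]]] := xD i.
  have /choice[u uP] : forall j, exists u : 'I_3 * V,
      o i (Acol t u.1 u.2) /\ s j = toMR'' R t_sum0 (ret (Acol t u.1 u.2)).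
    by move=> j; have [_ [k [q [oi ->]]] <-] := sS j; exists (k, q).
  (* The weights b_j sum to 1, so the component in R^r of this lift is exactly c_i times the i-th
     basis vector. *)
  exists (\sum_j (c i * b j) *: toMR R t (Acol t (u j).1 (u j).2)); split.
    exists p, (fun j => c i * b j), (fun j => toMR R t (Acol t (u j).1 (u j).2)).
    split=> // j; first by rewrite mulr_ge0.
    by exists (Acol t (u j).1 (u j).2) => //; do 2 eexists.
  rewrite raddf_sum.
  have -> : \sum_j psiR ((c i * b j) *: toMR R t (Acol t (u j).1 (u j).2)) =
      \sum_j ((c i * b j) *: delta_mx 0 i, (c i * b j) *: s j).
    apply: eq_bigr => j _; have [oj ->] := uP j.
    by rewrite linearZ /= (psiR_Acol oj).
  rewrite [LHS]surjective_pairing; congr pair; rewrite raddf_sum /=.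
    by rewrite -scaler_suml -mulr_sumr b1 mulr1.
  by rewrite scaler_sumr; apply: eq_bigr => j _; rewrite scalerA.
exists (\sum_i y i).
  by apply: conic_hull_sum => i; have [] := yP i.
rewrite raddf_sum (eq_bigr (fun i => (c i *: delta_mx 0 i, c i *: x i))).
  rewrite [LHS]surjective_pairing; congr pair; rewrite raddf_sum //=.
  rewrite [RHS]row_sum_delta; apply: eq_bigr => i _; by rewrite mxE.
by move=> i _; have [] := yP i.
Qed.

Lemma cayley_structure_pr : cayley_structure R t_sum0 pr.
Proof.
exists cell_polytope, psi, psiR; split=> //.
- exact: cell_polytopeP.
- exact: psi_bij.
- by move=> x; congr pair; [exact: prR_toMR|exact: retR_toMR].
- exact: psiR_sigma.
Qed.

Definition degree (x : ambientR R V) : R^o := \sum_k x.1 k.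

Lemma degree_is_linear : linear degree.
Proof.
move=> a x y; rewrite /degree scaler_sumr -big_split.
by apply: eq_bigr.
Qed.
HB.instance Definition _ :=
  GRing.isLinear.Build R (ambientR R V) R^o _ degree degree_is_linear.

Lemma degree_Acol k p : degree (real_vec R (Acol_vec t k p)) = 1.
Proof.
rewrite /degree /Acol_vec sum_ord3_neq (bigD1 k) //= big1 => [|l lk].
  by rewrite !addr0 /= eqxx.
by rewrite !addr0 /= (negPf lk).
Qed.

(** Every column has degree 1, so a nonnegative combination of columns lies in [Delta_tilde] exactly
    when its weights sum to 1. The same weights then serve on both sides, basis vectors being lifted
    to the chosen columns. *)
Lemma prR_Delta : prR @` Delta_tilde R t = conv_hull (range (fun i => delta_mx 0 i)).
Proof.
apply/seteqP; split.
  move=> _ [_ [[p [c [s [c0 sS ->]]]] deg1] <-].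
  have /choice[u uP] : forall j, exists u : 'I_3 * V * 'I_r,
      o u.2 (Acol t u.1.1 u.1.2) /\ s j = toMR R t (Acol t u.1.1 u.1.2).
    move=> j; have [_ [k [q ->]] <-] := sS j.
    by have [i oi] := o_cover k q; exists (k, q, i).
  exists p, c, (fun j => delta_mx 0 (u j).2); split=> //.
  - move: deg1; rewrite -/(degree _) !raddf_sum /= => <-.
    apply: eq_bigr => j _; rewrite !linearZ /=; have [_ ->] := uP j.
    by rewrite /= degree_Acol /GRing.scale /= mulr1.
  - rewrite raddf_sum /=; apply: eq_bigr => j _; rewrite linearZ /=.
    by have [oj ->] := uP j; rewrite (prR_Acol oj).
move=> _ [p [c [s [c0 c1 sS ->]]]].
have /choice[u uP] : forall j, exists i, s j = delta_mx 0 i.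
  by move=> j; have [i _ <-] := sS j; exists i.
exists (\sum_j c j *: toMR R t (rep (u j))).
  split.
    exists p, c, (fun j => toMR R t (rep (u j))); split=> // j.
    have [k [q [-> _ _]]] := repP (u j).
    by exists (Acol t k q) => //; exists k, q.
  rewrite -/(degree _) !raddf_sum -c1.
  apply: eq_bigr => j _; have [k [q [-> _ _]]] := repP (u j).
  by rewrite /= !linearZ /= degree_Acol /GRing.scale /= mulr1.
rewrite raddf_sum /=; apply: eq_bigr => j _; rewrite linearZ /= uP.
by have [k [q [-> /prR_Acol->]]] := repP (u j).
Qed.

Lemma cell_projection : exists pr : {additive M t -> 'rV[int]_r},
  [/\ short_exact (M_incl t_sum0) pr,
      (forall i k p, o i (Acol t k p) -> pr (Acol t k p) = delta_mx 0 i),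
      (exists prR : {linear MR R t -> 'rV[R]_r},
         (forall x, prR (toMR R t x) = map_mx intr (pr x)) /\
         prR @` Delta_tilde R t = conv_hull (range (fun i => delta_mx 0 i)))
    & cayley_structure R t_sum0 pr].
Proof.
exists pr; split.
- exact: exact_pr.
- exact: pr_Acol.
- by exists prR; split; [exact: prR_toMR|exact: prR_Delta].
- exact: cayley_structure_pr.
Qed.

End CellProjection.

(** * Generation of the vertex group by two of the translations *)

Section Generators.
Variables (R : realType) (Gamma : zmodClosed (TT R)).

(** A representative of [p] in the triangular lattice is handled by induction on the generators; the
    third translation is minus the sum of the two others. *)
Lemma tauV_gen k (p : vert Gamma) :
  exists y z : int, p = tauV Gamma k *~ y + tauV Gamma (k + 1) *~ z.
Proof.
rewrite -[p](@reprK _ (vert Gamma)); move: (repr p) => {p}.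
elim/lattice_gen_ind => [|x x' [y [z e]] [y' [z' e']]|x [l _ lE]].
- by exists 0, 0; rewrite !mulr0z addr0 !piE.
- exists (y - y'), (z - z'); rewrite !mulrzBr addrACA -opprD -e -e'.
  by rewrite !piE.
have -> : x = tau R l by exact: esym (val_inj _).
rewrite -/(tauV Gamma l).
have [->|->|->] := ord3_cases k l.
- by exists 1, 0; rewrite mulr1z mulr0z addr0.
- by exists 0, 1; rewrite mulr1z mulr0z add0r.
- by exists (-1), (-1); rewrite !mulrN1z (t_succ2 (tauV_sum0 Gamma)).
Qed.

End Generators.

Theorem theorem4p14 (R : realType) (n : nat) (Gamma : zmodClosed (TT R))
    (d : 'I_3 -> nat)
    (index_Gamma : ([set: vert Gamma] #= `I_n)%card)
    (poly_T : polyhedral Gamma)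
    (order_tau : forall k, is_order (tauV Gamma k) (d k)) :
  let t := tauV Gamma in
  let t_sum0 := tauV_sum0 Gamma in
  let r := (\sum_(k < 3) n %/ d k)%N in
  (cells t #= `I_r)%card /\
  forall o : 'I_r -> set (M t), injective o -> range o = cells t ->
  exists pr : {additive M t -> 'rV[int]_r},
    [/\ short_exact (M_incl t_sum0) pr,
        (forall i k p, o i (Acol t k p) -> pr (Acol t k p) = delta_mx 0 i),
        (exists prR : {linear MR R t -> 'rV[R]_r},
           (forall x, prR (toMR R t x) = map_mx intr (pr x)) /\
           prR @` Delta_tilde R t = conv_hull (range (fun i => delta_mx 0 i)))
      & cayley_structure R t_sum0 pr].
Proof.
move=> t t_sum0 r.
have [en bij_en] : exists en : 'I_n -> vert Gamma, bijective en.
  have /card_bijP[f bij_f] := card_eq_trans (card_esym card_II) (card_esym index_Gamma).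
  exists (fun i => \val (f (to_setT i))).
  apply: bij_comp; last exact: bij_comp.
  by exists to_setT => x //; apply: val_inj.
have gen_t : forall k p, exists y z : int, p = t k *~ y + t (k + 1) *~ z.
  by move=> k p; exact: tauV_gen.
have cellP := cell_Acol R t_sum0 bij_en order_tau gen_t.
have cellE := @cell_eq R _ _ t_sum0 _ _ _ bij_en order_tau gen_t.
split=> [|o o_inj o_range]; first exact: (card_cells R t_sum0 bij_en order_tau gen_t).
(* From here on, the hypotheses of [cell_projection] are checked for an arbitrary numbering [o] of
   the cells. *)
have o_cell i : exists k p, o i = cell t k p.
  have : cells t (o i) by rewrite -o_range; exists i.
  by [].
have o_cover k p : exists i, o i (Acol t k p).
  have [i _ oi] : range o (cell t k p) by rewrite o_range; exists k, p.
  by exists i; rewrite oi; apply/cellP; split=> //; exists 0; rewrite subrr.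
have o_uniq k p i j : o i (Acol t k p) -> o j (Acol t k p) -> i = j.
  have [[l [q oi]] [l' [q' oj]]] := (o_cell i, o_cell j).
  (* Two cells that share a column both equal the orbit of that column. *)
  by move=> ki kj; apply: o_inj; move: ki kj; rewrite oi oj => /cellE <- /cellE <-.
have o_stable i k p : o i (Acol t k p) -> o i (Acol t k (p - t k)).
  have [l [q ->]] := o_cell i.
  move=> /cellP[kl pq]; apply/cellP; split=> //; rewrite addrAC.
  by apply: in_cycleB pq _; exists 1; rewrite kl.
have finV : finite_set [set: vert Gamma] by apply/finite_setP; exists n.
have /choice[u oE] i : exists u : 'I_3 * vert Gamma, o i = cell t u.1 u.2.
  by have [k [p ->]] := o_cell i; exists (k, p).
pose F i : {linear ambientR R (vert Gamma) -> R^o} :=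
  cell_functional en order_tau gen_t (u i).1 (u i).2.
have F_Acol i k p :
    F i (real_vec R (Acol_vec t k p)) = `[< o i (Acol t k p) >]%:R.
  rewrite /F /= (cell_functional_Acol R t_sum0 bij_en) oE.
  by congr (nat_of_bool _)%:R; apply: asbool_equiv_eq; split=> /cellP.
exact: (cell_projection t_sum0 finV o_cell o_cover o_uniq o_stable F_Acol).
Qed.
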